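(* Every right reversible subsemigroup $S$ of $\Gamma$ is conjugate to a subsemigroup of $\mathcal Z$. In particular, every right amenable subsemigroup $S$ of $\Gamma$ is conjugate to a subsemigroup of $\mathcal Z$.
   Context: $k$ is an algebraically closed field of characteristic zero. The order of a nonzero formal power series over $k$ is the smallest exponent with nonzero coefficient. $\Gamma$ is the semigroup, under composition $\circ$, of (nonzero) formal power series over $k$ of order at least $2$; $k_1[[z]]$ is the group under $\circ$ of series of order exactly $1$. $\mathcal Z$ is the subsemigroup of $\Gamma$ consisting of all monomials $az^n$ with $a\in k^*$, $n\ge2$. Two subsemigroups $S_1,S_2$ of $\Gamma$ are conjugate if there is $\alpha\in k_1[[z]]$ with $\alpha\circ S_1\circ\alpha^{-1}=S_2$. A semigroup $S$ is right reversible if for all $a,b\in S$ there exist $x,y\in S$ with $xa=yb$. A semigroup $S$ is right amenable if it admits a finitely additive probability measure $\mu$ defined on all subsets of $S$ such that $\mu(Ta^{-1})=\mu(T)$ for all $a\in S$ and $T\subseteq S$, where $Ta^{-1}=\{s\in S : sa\in T\}$. (It is well known that right amenable semigroups are right reversible.) *)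

(* Defs.v *)
From mathcomp Require Import all_boot all_order all_algebra.
From mathcomp Require Import all_classical all_reals.

Set Implicit Arguments.
Unset Strict Implicit.
Unset Printing Implicit Defensive.

Import Order.TTheory GRing.Theory Num.Theory.
Local Open Scope classical_set_scope.
Local Open Scope ring_scope.

(* A formal power series is its sequence of coefficients. *)
Definition fps (K : nzRingType) : Type := nat -> K.

Section FormalPowerSeries.
Variable K : nzRingType.
Implicit Types f g : fps K.

Definition fps_monomial (a : K) (n : nat) : fps K :=
  fun i => if i == n then a else 0.

Definition fps_mul f g : fps K :=
  fun n => \sum_(i < n.+1) f i * g (n - i)%N.

Definition fps_exp f (m : nat) : fps K :=
  iter m (fps_mul f) (fps_monomial 1 0).

(* [f o g = \sum_m f_m g^m], meaningful when [g] has zero constant term: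
   then [g^m] has no coefficient of degree [< m], so that only the indices
   [m <= n] contribute to the coefficient of degree [n]. *)
Definition fps_comp f g : fps K :=
  fun n => \sum_(m < n.+1) f m * fps_exp g m n.

Definition has_order f (n : nat) : Prop :=
  f n != 0 /\ forall i, (i < n)%N -> f i = 0.

Definition Gamma : set (fps K) :=
  [set f | exists2 n, (2 <= n)%N & has_order f n].

Definition order_one : set (fps K) := [set f | has_order f 1].

Definition Zmonomials : set (fps K) :=
  [set f | exists a n, [/\ a != 0, (2 <= n)%N & f = fps_monomial a n]].

Definition fps_inverse f g : Prop :=
  fps_comp f g = fps_monomial 1 1 /\ fps_comp g f = fps_monomial 1 1.

Definition conjugate (S1 S2 : set (fps K)) : Prop :=
  exists alpha beta : fps K,
    [/\ order_one alpha, order_one beta, fps_inverse alpha beta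
      & [set fps_comp (fps_comp alpha s) beta | s in S1] = S2].

End FormalPowerSeries.

Section Semigroups.
Variables (G : Type) (op : G -> G -> G).

Definition subsemigroup (M S : set G) : Prop :=
  S `<=` M /\ forall a b, S a -> S b -> S (op a b).

Definition right_reversible (S : set G) : Prop :=
  forall a b, S a -> S b -> exists x y, [/\ S x, S y & op x a = op y b].

(* [T a^-1], computed inside [S] *)
Definition right_translate (S T : set G) (a : G) : set G :=
  [set s | S s /\ T (op s a)].

(* Only the values of [mu] on subsets of [S] are constrained. *)
Definition finitely_additive_probability (R : realType) (S : set G)
    (mu : set G -> R) : Prop :=
  [/\ forall A, A `<=` S -> 0 <= mu A,
      mu S = 1
    & forall A B, A `<=` S -> B `<=` S -> A `&` B = set0 ->
        mu (A `|` B) = mu A + mu B].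

Definition right_amenable (R : realType) (S : set G) : Prop :=
  exists2 mu : set G -> R, finitely_additive_probability S mu &
    forall a T, S a -> T `<=` S -> mu (right_translate S T a) = mu T.

End Semigroups.

(* Main.v *)
(* Every [A] in [S], of order [n >= 2], has a Boettcher coordinate, so after
   conjugation [z^n] lies in [S].  Suppose some [B = c z^m + b z^(m+r) + ...]
   in [S] has a second nonzero coefficient [b].  All the iterates of [B] are of
   the form [c' z^M + b' z^(M+r) + ...] with the same gap [r], and [M] can be
   made larger than [r]; then [Y o B^l] has gap [r] too, for every [Y] in [S].
   By reversibility some [Y o B^l] equals some [X o z^N], where [N] is a power
   of [n] exceeding [r].  Being a series in [z^N], it cannot have gap [r].
   Hence every element of the conjugated semigroup is a monomial. *)
Require Import Defs.
From mathcomp Require Import all_boot all_order all_algebra.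
From mathcomp Require Import all_classical all_reals.
From mathcomp Require Import zify ring lra.

Import Order.TTheory GRing.Theory Num.Theory.
Local Open Scope classical_set_scope.
Local Open Scope ring_scope.

(** * Powers and compositions of series, computed modulo powers of the variable *)

Section Truncation.
Set Implicit Arguments.
Unset Strict Implicit.
Unset Printing Implicit Defensive.
Variable K : comNzRingType.
Implicit Types (f g h u v : fps K) (p q : {poly K}).

Definition eq_upto n p q := forall i, (i < n)%N -> p`_i = q`_i.

Lemma eq_upto_mul n p p' q q' :
  eq_upto n p p' -> eq_upto n q q' -> eq_upto n (p * q) (p' * q').
Proof.
move=> epp eqq i lt_in; rewrite !coefM; apply: eq_bigr => j _.
by rewrite epp ?eqq //; have := ltn_ord j; lia.
Qed.

Lemma eq_upto_exp n p p' m : eq_upto n p p' -> eq_upto n (p ^+ m) (p' ^+ m).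
Proof.
by move=> epp; elim: m => [|m IHm] //; rewrite !exprS; apply: eq_upto_mul.
Qed.

Lemma coef_exp_lt p m i : p`_0 = 0 -> (i < m)%N -> (p ^+ m)`_i = 0.
Proof.
move=> p0; elim: m i => [|m IHm] i // lt_im; rewrite exprS coefM big1 // => j _.
case: (posnP j) => [->|j_gt0]; first by rewrite p0 mul0r.
by rewrite IHm ?mulr0 //; have := ltn_ord j; lia.
Qed.

(** As [q] has no constant term, [q ^+ m] starts in degree [m]. The sum may therefore stop at any
    [n > i], whatever the size of [p]. *)
Lemma coef_comp_upto n p q i : q`_0 = 0 -> (i < n)%N ->
  (p \Po q)`_i = \sum_(m < n) p`_m * (q ^+ m)`_i.
Proof.
move=> q0 lt_in; rewrite coef_comp_poly.
rewrite -!(big_mkord xpredT (fun m => p`_m * (q ^+ m)`_i)).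
have [le_sn|lt_ns] := leqP (size p) n.
  rewrite [RHS](@big_cat_nat _ _ _ (size p)) //= [X in _ + X]big_nat_cond.
  by rewrite [X in _ + X]big1 ?addr0 // => m /andP[/andP[? _] _];
    rewrite nth_default ?mul0r.
rewrite [LHS](@big_cat_nat _ _ _ n) //=; last exact: ltnW.
rewrite [X in _ + X]big_nat_cond.
rewrite [X in _ + X]big1 ?addr0 // => m /andP[/andP[? _] _].
by rewrite coef_exp_lt ?mulr0 //; lia.
Qed.

Lemma eq_upto_comp n p p' q q' : q`_0 = 0 -> q'`_0 = 0 ->
  eq_upto n p p' -> eq_upto n q q' -> eq_upto n (p \Po q) (p' \Po q').
Proof.
move=> q0 q'0 epp eqq i lt_in; rewrite !(@coef_comp_upto n) //.
by apply: eq_bigr => m _; rewrite epp // (@eq_upto_exp n q q').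
Qed.

Definition trunc n f : {poly K} := \poly_(i < n) f i.

Lemma coef_trunc n f i : (i < n)%N -> (trunc n f)`_i = f i.
Proof. by move=> lt_in; rewrite coef_poly lt_in. Qed.

Lemma trunc0 n f : f 0%N = 0 -> (trunc n f)`_0 = 0.
Proof. by rewrite coef_poly; case: ifP. Qed.

Lemma fps_exp_trunc n f m i : (i < n)%N -> fps_exp f m i = (trunc n f ^+ m)`_i.
Proof.
elim: m i => [|m IHm] i lt_in; first by rewrite expr0 coef1 /fps_exp /= /fps_monomial; case: eqP.
rewrite exprS coefM /fps_exp iterS /fps_mul; apply: eq_bigr => j _.
have := ltn_ord j => lt_ji.
by rewrite coef_trunc 1?[iter _ _ _ _]IHm //; lia.
Qed.

Lemma fps_exp_lt f m i : f 0%N = 0 -> (i < m)%N -> fps_exp f m i = 0.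
Proof.
move=> f0 lt_im; rewrite (@fps_exp_trunc i.+1) // coef_exp_lt //.
exact: trunc0.
Qed.

Lemma fps_comp_trunc n f g i : g 0%N = 0 -> (i < n)%N ->
  fps_comp f g i = (trunc n f \Po trunc n g)`_i.
Proof.
move=> g0 lt_in; rewrite (@coef_comp_upto i.+1) ?trunc0 //.
apply: eq_bigr => m _.
by rewrite (@fps_exp_trunc n) // coef_trunc //; have := ltn_ord m; lia.
Qed.

Lemma fps_comp0 f g : fps_comp f g 0%N = f 0%N.
Proof.
by rewrite /fps_comp big_ord_recl big_ord0 addr0 /fps_exp /fps_monomial /= mulr1.
Qed.

(** The coefficient of degree [i] depends only on truncations modulo ['X^i.+1], which reduces the
    claim to [comp_polyA]. *)
Lemma fps_compA f g h : g 0%N = 0 -> h 0%N = 0 ->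
  fps_comp (fps_comp f g) h = fps_comp f (fps_comp g h).
Proof.
move=> g0 h0; apply/funext => i.
have gh0 : fps_comp g h 0%N = 0 by rewrite fps_comp0.
rewrite (@fps_comp_trunc i.+1 _ h) // (@fps_comp_trunc i.+1 f _ i gh0) //.
have tg0 := @trunc0 i.+1 _ g0; have th0 := @trunc0 i.+1 _ h0.
have tgh0 : (trunc i.+1 g \Po trunc i.+1 h)`_0 = 0.
  by rewrite -(@fps_comp_trunc i.+1) // fps_comp0.
rewrite (@eq_upto_comp i.+1 _ (trunc i.+1 f \Po trunc i.+1 g) _ (trunc i.+1 h)) //;
  last by move=> j ltj; rewrite coef_trunc // (@fps_comp_trunc i.+1).
rewrite -comp_polyA; symmetry.
apply: (@eq_upto_comp i.+1) => //; first exact: trunc0.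
by move=> j ltj; rewrite coef_trunc // (@fps_comp_trunc i.+1).
Qed.

Lemma fps_comp_single f g d i : g 0%N = 0 ->
  (forall m, m != d -> f m * fps_exp g m i = 0) ->
  fps_comp f g i = f d * fps_exp g d i.
Proof.
move=> g0 zero_terms; rewrite /fps_comp.
have [le_di|lt_id] := leqP d i.
  rewrite (bigD1 (Ordinal (le_di : (d < i.+1)%N))) //= big1 ?addr0 // => m.
  by rewrite -val_eqE /=; apply: zero_terms.
rewrite fps_exp_lt // mulr0 big1 // => m _; apply: zero_terms.
by have := ltn_ord m; lia.
Qed.

Lemma fps_exp_monomial n m :
  fps_exp (fps_monomial (1 : K) n) m = fps_monomial 1 (m * n).
Proof.
(* The truncation must reach both the degree [i] being read and the degree [n], so that it is
   exactly ['X^n]. *)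
apply/funext => i; rewrite (@fps_exp_trunc (maxn i n).+1) 1?ltnS ?leq_maxl //.
have -> : trunc (maxn i n).+1 (fps_monomial 1 n) = 'X^n.
  apply/polyP => j; rewrite coef_poly coefXn /fps_monomial.
  by case: (eqVneq j n) => [->|_]; rewrite ?ltnS ?leq_maxr //; case: ifP.
by rewrite -exprM mulnC coefXn /fps_monomial; case: eqP.
Qed.

Lemma fps_comp_monomial n g : g 0%N = 0 ->
  fps_comp (fps_monomial 1 n) g = fps_exp g n.
Proof.
move=> g0; apply/funext => i; rewrite (@fps_comp_single _ _ n) //.
  by rewrite /fps_monomial eqxx mul1r.
by move=> m /negPf ne_mn; rewrite /fps_monomial ne_mn mul0r.
Qed.

Lemma fps_comp_to_monomial f n i : (0 < n)%N -> ~~ (n %| i)%N ->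
  fps_comp f (fps_monomial 1 n) i = 0.
Proof.
move=> n_gt0 ndvd; rewrite /fps_comp big1 // => m _.
rewrite fps_exp_monomial /fps_monomial; case: eqP => [i_eq|]; last by rewrite mulr0.
by rewrite i_eq dvdn_mull in ndvd.
Qed.

Lemma fps_comp1l f : f 0%N = 0 -> fps_comp (fps_monomial 1 1) f = f.
Proof.
move=> f0; rewrite fps_comp_monomial //; apply/funext => i.
by rewrite (@fps_exp_trunc i.+1) // expr1 coef_trunc.
Qed.

Lemma fps_comp1r f : fps_comp f (fps_monomial 1 1) = f.
Proof.
apply/funext => i; rewrite (@fps_comp_single _ _ i) //.
  by rewrite fps_exp_monomial muln1 /fps_monomial eqxx mulr1.
move=> m ne_mi; rewrite fps_exp_monomial muln1 /fps_monomial eq_sym.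
by rewrite (negPf ne_mi) mulr0.
Qed.

(** Write [f = z^p u]; then [f^d = z^(d p) u^d]. *)
Lemma fps_exp_shift f d (p : nat) i : (forall j, (j < p)%N -> f j = 0) ->
  fps_exp f d i =
    if (i < d * p)%N then 0 else fps_exp (fun j => f (p + j)%N) d (i - d * p)%N.
Proof.
move=> f_lt; rewrite (@fps_exp_trunc i.+1) //.
rewrite (@eq_upto_exp i.+1 _ ('X^p * trunc i.+1 (fun j => f (p + j)%N))) //.
  rewrite exprMn -exprM mulnC coefXnM; case: ifP => // _.
  by rewrite (@fps_exp_trunc i.+1) // ltnS leq_subr.
move=> j ltj; rewrite coefXnM coef_trunc //; case: ltnP => [/f_lt //|le_pj].
by rewrite coef_trunc ?subnKC //; lia.
Qed.

Lemma fps_exp_coef0 f d : fps_exp f d 0%N = f 0%N ^+ d.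
Proof. by rewrite (@fps_exp_trunc 1) // -!horner_coef0 horner_exp horner_coef0 coef_trunc. Qed.

(** First-order expansion: modulo [z^(j+1)], [u = v + e z^j] with [e = u j - v j], hence
    [u^d = v^d + d v^(d-1) e z^j], where only the constant term of [v^(d-1)] matters. *)
Lemma fps_exp_perturb u v d j : (0 < j)%N -> (forall i, (i < j)%N -> u i = v i) ->
  fps_exp u d j = fps_exp v d j + v 0%N ^+ d.-1 * (u j - v j) *+ d.
Proof.
move=> j_gt0 uv; have uv0 := uv _ j_gt0.
have low e i : (i < j)%N -> fps_exp u e i = fps_exp v e i.
  move=> lt_ij; rewrite !(@fps_exp_trunc j) //; apply: (@eq_upto_exp j) => // k ltk.
  by rewrite !coef_trunc // uv.
elim: d => [|d IHd]; first by rewrite mulr0n addr0.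
case: j j_gt0 uv low IHd => // j _ uv low IHd.
have expS (w : fps K) : fps_exp w d.+1 j.+1 = w 0%N * fps_exp w d j.+1 +
   (\sum_(i < j) w i.+1 * fps_exp w d (j - i)%N + w j.+1 * w 0%N ^+ d).
  rewrite /fps_exp iterS /fps_mul big_ord_recl subn0 big_ord_recr /=; congr (_ + (_ + _)).
  by rewrite subnn -fps_exp_coef0.
rewrite !expS uv0 IHd.
under eq_bigr => i _.
  rewrite uv ?ltnS // low; last by have := ltn_ord i; lia.
over.
move: (fps_exp v d j.+1) (\sum_(i < j) _) => E M.
rewrite mulrSr; move: (u j.+1) (v j.+1) (v 0%N) => a b c.
(* For [d = 0] the truncated exponent [d.-1] is harmless, since the term is multiplied by [d]. *)
have -> : c * (E + c ^+ d.-1 * (a - b) *+ d) = c * E + c ^+ d * (a - b) *+ d.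
  rewrite mulrDr -mulrnAr mulrA -exprS mulrnAr.
  by case: d {IHd expS} => //; rewrite !mulr0n.
by rewrite /=; move: (c ^+ d) (c ^+ d * _ *+ d) => x y; ring.
Qed.

End Truncation.

(** * Orders, and gaps between the first two exponents *)

Section Orders.
Set Implicit Arguments.
Unset Strict Implicit.
Unset Printing Implicit Defensive.
Variable K : idomainType.
Implicit Types f g : fps K.

Lemma has_order_exp f p d : has_order f p -> has_order (fps_exp f d) (d * p).
Proof.
move=> [fp f_lt]; split=> [|i lt_i]; rewrite (fps_exp_shift d _ f_lt) ?lt_i //.
by rewrite ltnn subnn fps_exp_coef0 addn0 expf_neq0.
Qed.

Lemma has_order_comp f g d p : (0 < p)%N -> has_order f d -> has_order g p ->
  has_order (fps_comp f g) (d * p).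
Proof.
move=> p_gt0 [fd f_lt] ord_g; have g0 := ord_g.2 _ p_gt0.
have single i : (i <= d * p)%N -> fps_comp f g i = f d * fps_exp g d i.
  move=> le_i; apply: fps_comp_single => // m; rewrite neq_ltn => /orP[/f_lt ->|lt_dm].
    by rewrite mul0r.
  rewrite (has_order_exp m ord_g).2 ?mulr0 //; apply: leq_ltn_trans le_i _.
  by rewrite ltn_pmul2r.
split=> [|i lt_i]; first by rewrite single // mulf_neq0 // (has_order_exp d ord_g).1.
by rewrite single 1?ltnW // (has_order_exp d ord_g).2 ?mulr0.
Qed.

Definition has_gap f p r :=
  [/\ f p != 0, f (p + r)%N != 0 &
      forall i, (i < p + r)%N -> i != p -> f i = 0].

Lemma has_gap_order f p r : has_gap f p r -> has_order f p.
Proof.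
by move=> [fp _ f_lt]; split=> // i lt_ip; apply: f_lt; lia.
Qed.

Lemma has_order_gap f p : has_order f p ->
  f = fps_monomial (f p) p \/ exists2 r, (0 < r)%N & has_gap f p r.
Proof.
move=> [fp f_lt]; have [[i fi]|no_gap] := pselect (exists i, (p < i)%N && (f i != 0)).
  right; case: (ex_minnP (ex_intro (fun i => (p < i)%N && (f i != 0)) i fi)) => m.
  move=> /andP[lt_pm fm] min_m; exists (m - p)%N; first by rewrite subn_gt0.
  split; rewrite ?subnKC 1?ltnW // => j lt_jm ne_jp.
  have [/f_lt //|le_pj] := ltnP j p.
  apply/eqP; apply: contraT => fj; suff: (m <= j)%N by lia.
  by apply: min_m; rewrite fj andbT; lia.
left; apply/funext => i; rewrite /fps_monomial; case: (eqVneq i p) => [->//|ne_ip].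
have [/f_lt //|le_pi] := ltnP i p.
apply/eqP; apply: contraT => fi; case: no_gap; exists i.
by rewrite fi andbT; lia.
Qed.

Hypothesis charK0 : [pchar K] =i pred0.

(** The second nonzero coefficient of the power is [d f_p^(d-1) f_(p+r)]; characteristic zero keeps
    it from vanishing. *)
Lemma has_gap_exp f p r d : (0 < d)%N -> (0 < r)%N -> has_gap f p r ->
  has_gap (fps_exp f d) (d * p) r.
Proof.
move=> d_gt0 r_gt0 gap_f; have [fp fpr f_gap] := gap_f.
have f_lt := (has_gap_order gap_f).2.
(* [f / z^p] agrees below degree [r] with the constant [v], whose powers have no coefficient of
   positive degree. *)
pose v : fps K := fps_monomial (f p) 0.
have vE i : (0 < i)%N -> v i = 0 by rewrite /v /fps_monomial; case: i.
have v_exp i : (0 < i)%N -> fps_exp v d i = 0.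
  move=> i_gt0; rewrite (@fps_exp_trunc _ i.+1) //.
  have -> : trunc i.+1 v = (f p)%:P.
    by apply/polyP => j; rewrite coef_poly coefC /v /fps_monomial; case: j => //= j; case: ifP.
  by rewrite -polyC_exp coefC gtn_eqF.
have coefE i : (0 < i <= r)%N ->
    fps_exp f d (d * p + i) = f p ^+ d.-1 * f (p + i)%N *+ d.
  move=> /andP[i_gt0 le_ir]; rewrite (fps_exp_shift d _ f_lt) ltnNge leq_addr /= addKn.
  rewrite (@fps_exp_perturb _ _ v) //; last first.
    move=> [|j] lt_ji; first by rewrite /v /fps_monomial addn0.
    by rewrite vE // f_gap //; lia.
  by rewrite v_exp // (vE i) // subr0 add0r.
split.
- exact: (has_order_exp d (has_gap_order gap_f)).1.
- rewrite coefE ?r_gt0 ?leqnn // -mulr_natr !mulf_neq0 ?expf_neq0 //.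
  by rewrite ((pcharf0P _).1 charK0) // -lt0n.
- move=> i lt_i ne_i; have [lt_idp|le_dpi] := ltnP i (d * p).
    exact: (has_order_exp d (has_gap_order gap_f)).2.
  rewrite -(subnKC le_dpi) coefE; last by lia.
  have lt_dpi : (d * p < i)%N by rewrite ltn_neqAle eq_sym ne_i.
  by rewrite (f_gap (p + _)%N) ?mulr0 ?mul0rn //; lia.
Qed.

(** The term [f_i g^i] starts in degree [i p]. The last hypothesis removes the terms with [i > d]
    that start by degree [d p + r], so up to there the composition is [f_d g^d]. *)
Lemma has_gap_comp f g d p r : (0 < d)%N -> (0 < p)%N -> (0 < r)%N ->
  has_order f d -> has_gap g p r ->
  (forall i, (d < i)%N -> (i * p <= d * p + r)%N -> f i = 0) ->
  has_gap (fps_comp f g) (d * p) r.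
Proof.
move=> d_gt0 p_gt0 r_gt0 [fd f_lt] gap_g f_gap; have ord_g := has_gap_order gap_g.
have single i : (i <= d * p + r)%N -> fps_comp f g i = f d * fps_exp g d i.
  move=> le_i; apply: fps_comp_single => [|m]; first exact: ord_g.2.
  rewrite neq_ltn => /orP[/f_lt ->|lt_dm]; first by rewrite mul0r.
  have [le_m|lt_m] := leqP (m * p) (d * p + r); first by rewrite f_gap ?mul0r.
  by rewrite (has_order_exp m ord_g).2 ?mulr0 //; apply: leq_ltn_trans le_i _.
have [gp gpr g_lt] := has_gap_exp d_gt0 r_gt0 gap_g.
split=> [||i lt_i ne_i].
- by rewrite single ?leq_addr // mulf_neq0.
- by rewrite single // mulf_neq0.
- by rewrite single 1?ltnW // g_lt ?mulr0.
Qed.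

End Orders.

(** * Recursive construction of series, and compositional inverses *)

Section Conjugation.
Set Implicit Arguments.
Unset Strict Implicit.
Unset Printing Implicit Defensive.
Variable K : fieldType.
Implicit Types f g : fps K.

Definition cutoff n f : fps K := fun i => if (i < n)%N then f i else 0.

Lemma fps_recursion (step : nat -> fps K -> K) :
  exists f : fps K, forall n, f n = step n (cutoff n f).
Proof.
(* [build n] lists the first [n] coefficients; reading it with default value 0 gives exactly the
   cutoff at [n]. *)
pose fix build n : seq K :=
  if n is n'.+1 then rcons (build n') (step n' (nth 0 (build n'))) else [::].
have size_build n : size (build n) = n by elim: n => //= n IHn; rewrite size_rcons IHn.
pose f : fps K := fun n => step n (nth 0 (build n)); exists f.
have buildE n i : (i < n)%N -> nth 0 (build n) i = f i.
  elim: n => // n IHn; rewrite ltnS /= nth_rcons size_build.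
  by case: ltngtP => // [/IHn|->].
move=> n; rewrite {1}/f; congr (step n _); apply/funext => i; rewrite /cutoff.
by case: ltnP => [/buildE //|le_ni]; rewrite nth_default // size_build.
Qed.

(** The system is triangular: in degree [n] the last unknown [g n] has the nonzero coefficient
    [f 1 ^+ n]. *)
Lemma left_inverse_exists f : order_one f ->
  exists2 g, order_one g & fps_comp g f = fps_monomial 1 1.
Proof.
move=> [f1 f_lt]; have f0 := f_lt 0%N isT.
have [g gE] := fps_recursion (fun n t =>
  (fps_monomial 1 1 n - \sum_(m < n) t m * fps_exp f m n) / f 1%N ^+ n).
have fnn n : fps_exp f n n = f 1%N ^+ n.
  by rewrite (fps_exp_shift n _ f_lt) muln1 ltnn subnn fps_exp_coef0 addn0.
exists g; last first.
  apply/funext => n; rewrite /fps_comp big_ord_recr /= fnn [g n]gE divfK ?expf_neq0 //.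
  rewrite addrC -addrA; apply/eqP; rewrite -subr_eq0 addrAC subrr add0r addrC subr_eq0.
  by apply/eqP/eq_bigr => m _; rewrite /cutoff ltn_ord.
split=> [|[|//] _]; rewrite gE; last by rewrite big_ord0 /fps_monomial subr0 mul0r.
rewrite big_ord_recl big_ord0 /fps_exp /= /fps_monomial /= mulr0 addr0 subr0 mul1r.
by rewrite invr_eq0 expf_neq0.
Qed.

Lemma inverse_exists f : order_one f ->
  exists2 g, order_one g & fps_inverse f g.
Proof.
move=> ord_f; have [g ord_g gf] := left_inverse_exists ord_f.
have [h ord_h hg] := left_inverse_exists ord_g.
have [f0 g0 h0] : [/\ f 0%N = 0, g 0%N = 0 & h 0%N = 0].
  by split; [apply: ord_f.2|apply: ord_g.2|apply: ord_h.2].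
exists g => //; split=> //.
(* A left inverse of [g] coincides with its right inverse: [f = (h o g) o f = h o (g o f) = h]. *)
suff -> : f = h by [].
by rewrite -[LHS]fps_comp1l // -hg fps_compA // gf fps_comp1r.
Qed.

End Conjugation.

(** * The Boettcher coordinate of a series of order at least 2 *)

Section Boettcher.
Set Implicit Arguments.
Unset Strict Implicit.
Unset Printing Implicit Defensive.
Variable K : closedFieldType.
Hypothesis charK0 : [pchar K] =i pred0.

(** The equation is solved degree by degree. Degree [n] requires [alpha_1^(n-1) = A_n], solvable by
    algebraic closure; each higher degree is linear in one new unknown, whose factor contains [n],
    invertible in characteristic zero. *)
Lemma boettcher (A : fps K) n : (1 < n)%N -> has_order A n ->
  exists2 alpha, order_one alpha &
    fps_comp alpha A = fps_comp (fps_monomial 1 n) alpha.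
Proof.
move=> n_gt1 ord_A; have [An A_lt] := ord_A; have n_gt0 := ltnW n_gt1.
have A0 := A_lt _ n_gt0.
have [c cE] : exists c : K, c ^+ n.-1 = A n.
  have n1_gt0 : (0 < n.-1)%N by lia.
  have [c cE] := solve_monicpoly (fun i => if i is 0%N then A n else 0) n1_gt0.
  exists c; rewrite cE; case: n.-1 n1_gt0 => // k _; rewrite big_ord_recl expr0 mulr1 big1 ?addr0 //.
  by move=> i _; rewrite /= mul0r.
have c_neq0 : c != 0.
  by apply: contraNneq An => c0; rewrite -cE c0 expr0n gtn_eqF ?eqxx //; lia.
have nR_neq0 : n%:R != 0 :> K by rewrite ((pcharf0P _).1 charK0) // -lt0n.
(* The coefficient of degree [n + j] of [alpha o A = alpha ^ n] reads
   [n c^(n-1) alpha_(j+1) = (expression in alpha_0, ..., alpha_j)]. *)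
have [alpha alphaE] := fps_recursion (fun i t =>
  if i is j.+1 then
    if j is 0%N then c else
    (fps_comp t A (n + j)%N - fps_exp t n (n + j)%N) / (c ^+ n.-1 * n%:R)
  else 0).
have alpha0 : alpha 0%N = 0 by rewrite alphaE.
have alpha1 : alpha 1%N = c by rewrite alphaE.
have alpha_lt i : (i < 1)%N -> alpha i = 0 by case: i.
have ord_alpha : order_one alpha by split; rewrite ?alpha1.
exists alpha => //; rewrite fps_comp_monomial //; apply/funext => i.
have ord_l := has_order_comp n_gt0 ord_alpha ord_A.
have ord_r := has_order_exp n ord_alpha; rewrite mul1n in ord_l; rewrite muln1 in ord_r.
have [lt_in|le_ni] := ltnP i n; first by rewrite ord_l.2 ?ord_r.2.
rewrite -(subnKC le_ni); case: (i - n)%N => [|j].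
  rewrite addn0 (@fps_comp_single _ _ _ 1%N) //; last first.
    move=> m ne_m1; case: m ne_m1 => [|m] ne_m1; first by rewrite alpha0 mul0r.
    rewrite (has_order_exp _ ord_A).2 ?mulr0 //.
    by rewrite -[X in (X < _)%N]mul1n ltn_pmul2r //; lia.
  rewrite -(fps_comp_monomial 1 A0) fps_comp1l // (fps_exp_shift n _ alpha_lt) muln1 ltnn subnn.
  by rewrite fps_exp_coef0 addn0 alpha1 -cE -exprS prednK.
pose t := cutoff j.+2 alpha.
have t_lt k : (k < 1)%N -> t k = 0 by case: k.
(* The new unknown [alpha j.+2] is absent from this side: terms with [m >= j + 2] have order at
   least [(j + 2) n > n + j + 1], because [n > 1]. *)
have -> : fps_comp alpha A (n + j.+1) = fps_comp t A (n + j.+1).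
  apply: eq_bigr => m _; rewrite /t /cutoff; case: ltnP => // lt_jm.
  rewrite (has_order_exp _ ord_A).2 ?mulr0 //.
  apply: leq_trans (leq_mul lt_jm (leqnn n)).
  by rewrite mulSn ltn_add2l ltn_Pmulr.
have shiftE (f : fps K) : (forall k, (k < 1)%N -> f k = 0) ->
    fps_exp f n (n + j.+1) = fps_exp (fun k => f (1 + k)%N) n j.+1.
  by move=> f_lt; rewrite (fps_exp_shift n _ f_lt) muln1 ltnNge leq_addr /= addKn.
rewrite (shiftE alpha alpha_lt).
(* [alpha / z] and [t / z] first may differ in degree [j + 1], where [t / z] has coefficient 0; the
   unknown thus enters linearly. *)
rewrite (@fps_exp_perturb _ _ (fun k => t (1 + k)%N)) //; last first.
  by move=> k lt_kj; rewrite /t /cutoff ifT //; lia.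
rewrite -(shiftE t t_lt) [t (1 + 0)%N]alpha1 [t (1 + j.+1)%N]/t /cutoff ltnn subr0.
have -> : alpha (1 + j.+1)%N =
    (fps_comp t A (n + j.+1) - fps_exp t n (n + j.+1)) / (c ^+ n.-1 * n%:R).
  by rewrite alphaE.
rewrite -mulr_natr mulrAC mulrCA divff ?mulf_neq0 ?expf_neq0 //.
by rewrite mulr1 [RHS]addrC subrK.
Qed.

End Boettcher.

(** * Right reversible semigroups of series *)

Section Reversible.
Set Implicit Arguments.
Unset Strict Implicit.
Unset Printing Implicit Defensive.
Variable K : closedFieldType.
Hypothesis charK0 : [pchar K] =i pred0.
Implicit Types (S : set (fps K)) (B : fps K).

Lemma Gamma_coef0 B : Gamma B -> B 0%N = 0.
Proof. by move=> [[|n] // _ [_ B_lt]]; apply: B_lt. Qed.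

Lemma large_monomial S n l : (forall a b, S a -> S b -> S (fps_comp a b)) ->
  (1 < n)%N -> S (fps_monomial 1 n) -> exists2 N, (l < N)%N & S (fps_monomial 1 N).
Proof.
move=> S_comp n_gt1 Sn; elim: l => [|l [N lt_lN SN]]; first by exists n => //; lia.
exists (n * N)%N; first by nia.
rewrite -fps_exp_monomial -fps_comp_monomial; first exact: S_comp.
by rewrite /fps_monomial; case: N lt_lN {SN}.
Qed.

(** Composing with [B] on the right multiplies the order by [m] and keeps the gap: the second term
    of [B'] contributes only from degree [(M + r) m], beyond [M m + r] since [m > 1]. *)
Lemma large_gap S B m r l : (forall a b, S a -> S b -> S (fps_comp a b)) ->
  (1 < m)%N -> (0 < r)%N -> S B -> has_gap B m r ->
  exists M B', [/\ (l < M)%N, S B' & has_gap B' M r].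
Proof.
move=> S_comp m_gt1 r_gt0 SB gap_B.
elim: l => [|l [M [B' [lt_lM SB' gap_B']]]]; first by exists m, B; split=> //; lia.
exists (M * m)%N, (fps_comp B' B); split; [by nia|exact: S_comp|].
apply: has_gap_comp => //; [by lia|by lia|exact: has_gap_order gap_B'|].
by move=> i lt_Mi le_i; case: gap_B' => _ _; apply; nia.
Qed.

Lemma reversible_monomial S n : subsemigroup (@fps_comp K) (@Gamma K) S ->
  right_reversible (@fps_comp K) S -> (1 < n)%N -> S (fps_monomial 1 n) ->
  S `<=` @Zmonomials K.
Proof.
move=> [S_Gamma S_comp] S_rev n_gt1 Sn B SB; have [m m_gt1 ord_B] := S_Gamma B SB.
have [->|[r r_gt0 gap_B]] := has_order_gap ord_B.
  by exists (B m), m; split=> //; exact: ord_B.1.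
have [N lt_rN SN] := large_monomial r S_comp n_gt1 Sn.
have [M [B' [lt_rM SB' gap_B']]] := large_gap r S_comp m_gt1 r_gt0 SB gap_B.
have [X [Y [_ SY eqXY]]] := S_rev _ _ SN SB'.
have [d d_gt1 ord_Y] := S_Gamma Y SY.
(* Nothing is needed about the later coefficients of [Y]: for [i > d],
   [i M >= d M + M > d M + r]. *)
have [||i lt_di le_i|c1 c2 _] := has_gap_comp charK0 _ _ r_gt0 ord_Y gap_B'; try lia.
  by nia.
have dvdN i : fps_comp Y B' i != 0 -> (N %| i)%N.
  by apply: contraTT => ndvd; rewrite -eqXY negbK fps_comp_to_monomial ?eqxx //; lia.
(* Both exponents [d M] and [d M + r] occur in a series in [z^N], so [N] divides [r], although
   [r < N]. *)
have /(dvdn_leq r_gt0) : (N %| r)%N by rewrite -(dvdn_addr _ (dvdN _ c1)) dvdN.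
by lia.
Qed.

Lemma right_reversible_conjugate S : subsemigroup (@fps_comp K) (@Gamma K) S ->
  right_reversible (@fps_comp K) S ->
  exists2 S' : set (fps K),
    subsemigroup (@fps_comp K) (@Zmonomials K) S' & conjugate S S'.
Proof.
move=> [S_Gamma S_comp] S_rev.
have [[A SA]|S_empty] := pselect (exists A, S A); last first.
  (* An empty [S] offers no element to normalise; the identity conjugates it to itself. *)
  exists set0; first by split=> [s []|a b []].
  have ord1 : order_one (fps_monomial (1 : K) 1).
    by split=> [|[|//] _]; rewrite /fps_monomial ?oner_neq0.
  exists (fps_monomial 1 1), (fps_monomial 1 1); split=> //; first by split; exact: fps_comp1r.
  by apply/seteqP; split=> [f [s Ss]|f []]; case: S_empty; exists s.
have [n n_gt1 ord_A] := S_Gamma A SA.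
have [alpha ord_al alA] := boettcher charK0 n_gt1 ord_A.
have [beta ord_be inv] := inverse_exists ord_al; have [al_be be_al] := inv.
have al0 := ord_al.2 0%N isT; have be0 := ord_be.2 0%N isT.
pose c s := fps_comp (fps_comp alpha s) beta.
have c_comp a b : S a -> S b -> c (fps_comp a b) = fps_comp (c a) (c b).
  move=> /S_Gamma/Gamma_coef0 a0 /S_Gamma/Gamma_coef0 b0.
  rewrite /c [RHS]fps_compA ?fps_comp0 //.
  have -> : fps_comp beta (fps_comp (fps_comp alpha b) beta) = fps_comp b beta.
    by rewrite -fps_compA ?fps_comp0 // -(fps_compA beta) // be_al fps_comp1l.
  by rewrite -(fps_compA (fps_comp alpha a)) // (fps_compA alpha a0 b0).
exists (c @` S); last by exists alpha, beta.
have cS_comp a b : (c @` S) a -> (c @` S) b -> (c @` S) (fps_comp a b).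
  move=> [s Ss <-] [t St <-]; exists (fps_comp s t); first exact: S_comp.
  exact: c_comp.
have cS_Gamma : c @` S `<=` @Gamma K.
  move=> _ [s Ss <-]; have [m m_gt1 ord_s] := S_Gamma s Ss; exists m => //.
  rewrite -[m]muln1 -[X in (X * 1)%N]mul1n; apply: has_order_comp => //.
  by apply: has_order_comp => //; lia.
split=> //; apply: (@reversible_monomial _ n) => //.
- move=> _ _ [a Sa <-] [b Sb <-]; have [x [y [Sx Sy eqxy]]] := S_rev a b Sa Sb.
  exists (c x), (c y); split; [by exists x|by exists y|].
  by rewrite -!c_comp // eqxy.
- by exists A => //; rewrite /c alA fps_compA // al_be fps_comp1r.
Qed.

End Reversible.

(** Each left ideal [S x] has measure 1, because its translate by [x] is all of [S]. Disjoint [S a]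
    and [S b] would have a union of measure 2. *)
Lemma right_amenable_reversible (R : realType) (G : Type) (op : G -> G -> G)
    (S : set G) : (forall a b, S a -> S b -> S (op a b)) ->
  right_amenable op R S -> right_reversible op S.
Proof.
move=> S_op [mu [mu_ge0 muS mu_add] mu_inv] a b Sa Sb.
pose ideal a := [set op s a | s in S].
have ideal_sub x : S x -> ideal x `<=` S by move=> Sx _ [s Ss <-]; apply: S_op.
have mu_ideal x : S x -> mu (ideal x) = 1.
  move=> Sx; rewrite -(mu_inv x _ Sx (ideal_sub x Sx)) -muS; congr mu.
  by apply/seteqP; split=> [s []//|s Ss]; split=> //; exists s.
apply: contrapT => no_common.
have disj : ideal a `&` ideal b = set0.
  apply/seteqP; split=> // z [[x Sx xa] [y Sy yb]]; case: no_common.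
  by exists x, y; rewrite xa yb.
have U_sub : ideal a `|` ideal b `<=` S by move=> z [/ideal_sub|/ideal_sub]; apply.
have muU := mu_add _ _ (ideal_sub a Sa) (ideal_sub b Sb) disj.
have D_sub : S `\` (ideal a `|` ideal b) `<=` S by move=> z [].
(* Additivity over the complement stands in for monotonicity: it gives [1 = 2 + mu D] with
   [mu D >= 0]. *)
have := mu_add _ _ U_sub D_sub (setDIK _ _).
rewrite setDUK ?muS ?muU ?mu_ideal // => mu_eq.
have := mu_ge0 _ D_sub; lra.
Qed.

Theorem theorem7p2 (R : realType) (K : closedFieldType)
    (charK0 : [pchar K] =i pred0) :
  (forall S : set (fps K),
     subsemigroup (@fps_comp K) (@Gamma K) S ->
     right_reversible (@fps_comp K) S ->
     exists2 S' : set (fps K),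
       subsemigroup (@fps_comp K) (@Zmonomials K) S' & conjugate S S')
  /\
  (forall S : set (fps K),
     subsemigroup (@fps_comp K) (@Gamma K) S ->
     right_amenable (@fps_comp K) R S ->
     exists2 S' : set (fps K),
       subsemigroup (@fps_comp K) (@Zmonomials K) S' & conjugate S S').
Proof.
split=> S S_sub; first exact: right_reversible_conjugate.
by move=> /(right_amenable_reversible S_sub.2); apply: right_reversible_conjugate.
Qed.
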